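(* In the setting described in the context, insertion of the entering constraint's normal $n_*$ into the working set is performed only after a full step; a full step requires $t_2<\infty$ and hence $z\ne0$. In that case, for any orthogonal $W_2\in\mathbb{R}^{(n-k)\times(n-k)}$ and $\alpha\in\mathbb{R}$ with $W_2^{\top}d_2=\alpha e_1$, one has $\alpha\ne0$; consequently $$R'=\begin{bmatrix}R&d_1\\0&\alpha\end{bmatrix}$$ is nonsingular, and $A'=[\,A\ \ n_*\,]\in\mathbb{R}^{n\times(k+1)}$ has full column rank $k+1$.
   Context: $G\in\mathbb{R}^{n\times n}$ is symmetric positive definite; $A\in\mathbb{R}^{n\times k}$ has full column rank and holds the normals of the current working set; $J\in\mathbb{R}^{n\times n}$ and the upper triangular nonsingular $R\in\mathbb{R}^{k\times k}$ satisfy $J^{\top}GJ=I_n$ and $J^{\top}A=\begin{bmatrix}R\\0\end{bmatrix}$. Partition $J=[\,J_1\ \ J_2\,]$ with $J_1\in\mathbb{R}^{n\times k}$. The entering constraint has normal $n_*\in\mathbb{R}^n$, right-hand side $b_*\in\mathbb{R}$, and at the current point $x$ its slack is $s_*=n_*^{\top}x-b_*\neq0$. Set $d=J^{\top}n_*=(d_1,d_2)$ with $d_1\in\mathbb{R}^k$, $z=J_2d_2$. The primal step limit (in magnitude) is $t_2=|s_*|/(n_*^{\top}z)$ if $z\ne0$ and $t_2=+\infty$ if $z=0$. A dual step limit $t_1\in[0,+\infty]$ is also given. If $t_1=t_2=+\infty$ the iteration stops; otherwise the step is called full when $t_2\le t_1$ and partial when $t_1<t_2$. After a full step the constraint is inserted: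 with $W=\mathrm{diag}(I_k,W_2)$ the factors are updated to $J'=JW$ and $R'$, where $e_1$ is the first unit vector of $\mathbb{R}^{n-k}$ and $W_2^{\top}d_2=\alpha e_1$. *)

(* Defs.v *)
From HB Require Import structures.
From mathcomp Require Import all_boot all_order all_algebra.
From mathcomp Require Import reals constructive_ereal.

Set Implicit Arguments.
Unset Strict Implicit.
Unset Printing Implicit Defensive.

Import Order.TTheory GRing.Theory Num.Theory.
Local Open Scope ring_scope.

Definition symmetric_posdef (F : realType) (n : nat) (G : 'M[F]_n) : Prop :=
  G^T = G /\ forall x : 'cV[F]_n, x != 0 -> 0 < (x^T *m G *m x) 0 0.

Definition upper_triangular (F : realType) (k : nat) (R : 'M[F]_k) : Prop :=
  forall i j : 'I_k, (j < i)%N -> R i j = 0.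

Definition orthogonal_mx (F : realType) (m : nat) (W : 'M[F]_m) : Prop :=
  W^T *m W = 1%:M.

Definition full_column_rank (F : realType) (n k : nat) (A : 'M[F]_(n, k)) :
  Prop := \rank A = k.

(* Defined for every m; for m = 0 it is the empty vector. *)
Definition e1 (F : realType) (m : nat) : 'cV[F]_m :=
  \col_(i < m) (nat_of_ord i == 0%N)%:R.

(* The ambient dimension is written k + m: a full column rank n x k matrix has
   k <= n, so m stands for n - k, and the column partition J = [J1 J2] is the
   one carried by the type 'M_(k + m). *)

Definition slack (F : realType) (n : nat) (nstar : 'cV[F]_n) (bstar : F)
  (x : 'cV[F]_n) : F := (nstar^T *m x) 0 0 - bstar.

Definition dvec (F : realType) (k m : nat) (J : 'M[F]_(k + m))
  (nstar : 'cV[F]_(k + m)) : 'cV[F]_(k + m) := J^T *m nstar.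

Definition d1 (F : realType) (k m : nat) (J : 'M[F]_(k + m))
  (nstar : 'cV[F]_(k + m)) : 'cV[F]_k := usubmx (dvec J nstar).

Definition d2 (F : realType) (k m : nat) (J : 'M[F]_(k + m))
  (nstar : 'cV[F]_(k + m)) : 'cV[F]_m := dsubmx (dvec J nstar).

Definition zdir (F : realType) (k m : nat) (J : 'M[F]_(k + m))
  (nstar : 'cV[F]_(k + m)) : 'cV[F]_(k + m) := rsubmx J *m d2 J nstar.

Definition primal_limit (F : realType) (k m : nat) (J : 'M[F]_(k + m))
  (nstar : 'cV[F]_(k + m)) (bstar : F) (x : 'cV[F]_(k + m)) : \bar F :=
  if zdir J nstar == 0 then +oo%E
  else (`|slack nstar bstar x| / (nstar^T *m zdir J nstar) 0 0)%:E.

Inductive step_kind : Type := Stop | FullStep | PartialStep.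

Definition classify_step (F : realType) (t1 t2 : \bar F) : step_kind :=
  if (t1 == +oo%E) && (t2 == +oo%E) then Stop
  else if (t2 <= t1)%E then FullStep
  else PartialStep.

Definition updated_R (F : realType) (k m : nat) (J : 'M[F]_(k + m))
  (R : 'M[F]_k) (nstar : 'cV[F]_(k + m)) (alpha : F) : 'M[F]_(k + 1) :=
  block_mx R (d1 J nstar) 0 alpha%:M.

Definition updated_A (F : realType) (k m : nat) (A : 'M[F]_(k + m, k))
  (nstar : 'cV[F]_(k + m)) : 'M[F]_(k + m, k + 1) :=
  row_mx A nstar.

(* [insertion A J R nstar bstar x t1 A' J' R']: the iteration with dual step
   limit t1 inserts nstar into the working set, replacing the normals and
   factors (A, J, R) by (A', J', R'). The iteration performs an insertion in
   the full-step branch and in no other, hence the single constructor. *)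
Inductive insertion (F : realType) (k m : nat) (A : 'M[F]_(k + m, k))
    (J : 'M[F]_(k + m)) (R : 'M[F]_k) (nstar : 'cV[F]_(k + m)) (bstar : F)
    (x : 'cV[F]_(k + m)) (t1 : \bar F) :
    'M[F]_(k + m, k + 1) -> 'M[F]_(k + m) -> 'M[F]_(k + 1) -> Prop :=
| InsertAfterFullStep (W2 : 'M[F]_m) (alpha : F) of
    classify_step t1 (primal_limit J nstar bstar x) = FullStep &
    orthogonal_mx W2 &
    W2^T *m d2 J nstar = alpha *: e1 F m :
    insertion A J R nstar bstar x t1
      (updated_A A nstar)
      (J *m block_mx 1%:M 0 0 W2)
      (updated_R J R nstar alpha).

(* Main.v *)
(* Since W2 is orthogonal, alpha = 0 would give d2 = 0, hence z = J2 d2 = 0.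
   As for the rank, J^T A' = [R d1; 0 d2]: a vector (u, c) in its kernel
   satisfies c d2 = 0, hence c = 0, and then R u = 0, hence u = 0. *)

Require Import Defs.
From HB Require Import structures.
From mathcomp Require Import all_boot all_order all_algebra.
From mathcomp Require Import reals constructive_ereal.

Set Implicit Arguments.
Unset Strict Implicit.
Unset Printing Implicit Defensive.

Import Order.TTheory GRing.Theory Num.Theory.
Local Open Scope ring_scope.

(** With [t2] infinite, [t2 <= t1] forces [t1] to be infinite as well, and that pair is caught by
    the [Stop] test, which comes first. *)
Lemma full_step_lt_pinfty (F : realType) (t1 t2 : \bar F) :
  classify_step t1 t2 = FullStep -> (t2 < +oo)%E.
Proof.
rewrite /classify_step ltey; case: (t2 =P +oo%E) => // ->.
by rewrite leye_eq andbT; case: (t1 == _).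
Qed.

Lemma primal_limit_zdir_neq0 (F : realType) (k m : nat) (J : 'M[F]_(k + m))
    (nstar x : 'cV[F]_(k + m)) (bstar : F) :
  (primal_limit J nstar bstar x < +oo)%E -> zdir J nstar != 0.
Proof. by rewrite /primal_limit; case: eqP. Qed.

Lemma zdir_d2_neq0 (F : realType) (k m : nat) (J : 'M[F]_(k + m))
    (nstar : 'cV[F]_(k + m)) :
  zdir J nstar != 0 -> d2 J nstar != 0.
Proof. by apply: contra_neq; rewrite /zdir => ->; rewrite mulmx0. Qed.

Lemma orthogonal_scale_neq0 (F : realType) (m : nat) (W : 'M[F]_m)
    (d e : 'cV[F]_m) (alpha : F) :
  orthogonal_mx W -> W^T *m d = alpha *: e -> d != 0 -> alpha != 0.
Proof.
move=> hW hd; apply: contra_neq => alpha0.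
(* [mulmx1C] turns the left inverse [W^T] of the square [W] into a right inverse, so that
   [d = W (W^T d)]. *)
by rewrite -[d]mul1mx -(mulmx1C hW) -mulmxA hd alpha0 scale0r mulmx0.
Qed.

Lemma updated_R_unit (F : realType) (k m : nat) (J : 'M[F]_(k + m))
    (R : 'M[F]_k) (nstar : 'cV[F]_(k + m)) (alpha : F) :
  R \in unitmx -> alpha != 0 -> updated_R J R nstar alpha \in unitmx.
Proof.
rewrite !unitmxE !unitfE => R0 alpha0.
by rewrite det_ublock det_scalar1 mulf_neq0.
Qed.

Lemma updated_A_full_column_rank (F : realType) (k m : nat)
    (A : 'M[F]_(k + m, k)) (J : 'M[F]_(k + m)) (R : 'M[F]_k)
    (nstar : 'cV[F]_(k + m)) :
  R \in unitmx -> J^T *m A = col_mx R 0 -> d2 J nstar != 0 ->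
  full_column_rank (updated_A A nstar).
Proof.
(* Row freeness of the transpose is tested on row vectors [v]; transposing back makes [v^T = (u, c)]
   a kernel vector of [[A nstar]]. *)
move=> hR hJA hd2; rewrite /full_column_rank -mxrank_tr; apply/eqP.
apply: inj_row_free => v /(congr1 trmx).
rewrite trmx_mul trmxK trmx0 -[RHS]trmx0 => hv; apply: trmx_inj; move: hv.
rewrite !trmx0 -[v^T]vsubmxK; set u := usubmx _; set c := dsubmx _.
(* Multiplying [A u + nstar c = 0] by [J^T] splits it into [R u + d1 c = 0] and [d2 c = 0]. *)
rewrite /updated_A mul_row_col => /(congr1 (mulmx J^T)).
rewrite mulmx0 mulmxDr !mulmxA hJA -/(dvec J nstar) -[dvec _ _]vsubmxK.
rewrite -/(d1 J nstar) -/(d2 J nstar) !mul_col_mx mul0mx add_col_mx add0r.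
rewrite -[RHS]col_mx0 => /eq_col_mx[hu].
(* The block [c] is 1 x 1, so [d2 c] is a scalar multiple of the nonzero vector [d2]. *)
rewrite [c]mx11_scalar mul_mx_scalar => /eqP.
rewrite scaler_eq0 (negPf hd2) orbF => /eqP c0; move: hu.
rewrite [c]mx11_scalar c0 raddf0 mulmx0 addr0.
move=> /(congr1 (mulmx (invmx R))); rewrite mulKmx // mulmx0 => ->.
by rewrite mxE raddf0 col_mx0.
Qed.

Theorem proposition6p1 (F : realType) (k m : nat)
  (G : 'M[F]_(k + m)) (A : 'M[F]_(k + m, k))
  (J : 'M[F]_(k + m)) (R : 'M[F]_k)
  (nstar x : 'cV[F]_(k + m)) (bstar : F) (t1 : \bar F)
  (hG : symmetric_posdef G)
  (hA : full_column_rank A)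
  (hRtri : upper_triangular R) (hRns : R \in unitmx)
  (hJG : J^T *m G *m J = 1%:M)
  (hJA : J^T *m A = col_mx R 0)
  (hs : slack nstar bstar x != 0)
  (ht1 : (0 <= t1)%E) :
  let t2 := primal_limit J nstar bstar x in
  let z := zdir J nstar in
  [/\ (forall A' J' R', insertion A J R nstar bstar x t1 A' J' R' ->
         classify_step t1 t2 = FullStep),
      (classify_step t1 t2 = FullStep -> (t2 < +oo)%E),
      ((t2 < +oo)%E -> z != 0) &
      (classify_step t1 t2 = FullStep ->
         forall (W2 : 'M[F]_m) (alpha : F),
           orthogonal_mx W2 ->
           W2^T *m d2 J nstar = alpha *: e1 F m ->
           [/\ alpha != 0,
               updated_R J R nstar alpha \in unitmx &
               full_column_rank (updated_A A nstar)])].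
Proof.
split.
- by move=> A' J' R' [].
- exact: full_step_lt_pinfty.
- exact: primal_limit_zdir_neq0.
- move=> hfull W2 alpha hW hd.
  (* This also excludes [m = 0], where [hd] would hold for every [alpha]: there [d2] is empty, so
     [z = 0] and no step is full. *)
  have hd2 : d2 J nstar != 0.
    by apply/zdir_d2_neq0/primal_limit_zdir_neq0/full_step_lt_pinfty/hfull.
  have halpha := orthogonal_scale_neq0 hW hd hd2.
  split=> //; first exact: updated_R_unit.
  exact: updated_A_full_column_rank hJA hd2.
Qed.
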